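(* Let $n\in\mathbb{N}$, let $K$ be a singular, strictly concave and strictly monotone kernel function and let $J:[0,1]\to\mathbb{R}\cup\{-\infty\}$ be an upper semicontinuous $n$-field function. Let $r_1,\dots,r_n>0$ and consider the sum of translates function $F(\mathbf{y},t)=J(t)+\sum_{j=1}^n r_jK(t-y_j)$. If $\mathbf{y}\in\overline{S}$ is a maximum point of $\underline{m}$ on $\overline{S}$ (a maximin point), i.e., $\underline{m}(\mathbf{y})=m(\overline{S}):=\max_{\overline{S}}\underline{m}$, then $\mathbf{y}\in Y\subseteq S$, and $\mathbf{y}$ is an equioscillation point, i.e. $m_0(\mathbf{y})=m_1(\mathbf{y})=\ldots=m_n(\mathbf{y})$.
   Context: A kernel function is a function $K:(-1,0)\cup(0,1)\to\mathbb{R}$ that is concave on $(-1,0)$ and concave on $(0,1)$ and satisfies $\lim_{t\downarrow0}K(t)=\lim_{t\uparrow0}K(t)$. It is extended to $[-1,1]$, with values in $\mathbb{R}\cup\{-\infty\}$, by $K(0):=\lim_{t\to0}K(t)$, $K(-1):=\lim_{t\downarrow-1}K(t)$, $K(1):=\lim_{t\uparrow1}K(t)$. $K$ is singular if $K(0)=-\infty$; strictly concave if it is strictly concave on each of $(-1,0)$ and $(0,1)$; strictly monotone if it is strictly decreasing on $[-1,0)$ and strictly increasing on $(0,1]$. An $n$-field function is a function $J:[0,1]\to\mathbb{R}\cup\{-\infty\}$ that is bounded above and takes finite values at more than $n$ different points, where the points $0$ and $1$ are counted with weight $1/2$ and points of $(0,1)$ with weight $1$. Let $S:=\{\mathbf{y}=(y_1,\dots,y_n)\in(0,1)^n: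 0<y_1<\cdots<y_n<1\}$ and $\overline{S}:=\{\mathbf{y}\in[0,1]^n:0\le y_1\le\cdots\le y_n\le1\}$. The function $F$ is defined for $\mathbf{y}\in\overline{S}$, $t\in[0,1]$. With $y_0:=0$, $y_{n+1}:=1$ put $I_j(\mathbf{y}):=[y_j,y_{j+1}]$ and $m_j(\mathbf{y}):=\sup_{t\in I_j(\mathbf{y})}F(\mathbf{y},t)$ for $j=0,1,\dots,n$, and $\underline{m}(\mathbf{y}):=\min_{j=0,\dots,n}m_j(\mathbf{y})$. The regularity set is $Y:=\{\mathbf{y}\in S: m_j(\mathbf{y})\ne-\infty\text{ for }j=0,1,\dots,n\}$. *)

(* Defs.v *)
From HB Require Import structures.
From mathcomp Require Import all_boot all_order all_algebra.
From mathcomp Require Import all_classical all_reals all_analysis.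

Set Implicit Arguments.
Unset Strict Implicit.
Unset Printing Implicit Defensive.

Import Order.TTheory GRing.Theory Num.Theory.
Import numFieldNormedType.Exports.

Local Open Scope classical_set_scope.
Local Open Scope ring_scope.

Section Kernel.
Context {R : realType}.

Definition concave_on (D : set R^o) (f : R -> R) : Prop :=
  @convex_function R R^o D (fun x => - f x).

Definition strictly_concave_on (D : set R) (f : R -> R) : Prop :=
  {in D &, forall x y, x != y -> forall p : R, 0 < p < 1 ->
    p * f x + (1 - p) * f y < f (p * x + (1 - p) * y)}.

(* A kernel is a total function K : R -> R of which only the values on
   (-1,0) and (0,1) are ever used.  The common one-sided limit at 0 is taken
   in \bar R, since it may be -oo; by concavity it is never +oo. *)
Definition kernel_function (K : R -> R) : Prop :=
  [/\ concave_on `]-1, 0[ K, concave_on `]0, 1[ K &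
      exists l : \bar R,
        (EFin \o K) @ 0^'- --> l /\ (EFin \o K) @ 0^'+ --> l].

(* The extension of K to [-1,1] with values in R `|` {-oo}. For a kernel
   function the limits below exist, by concavity. *)
Definition kernel_ext (K : R -> R) (t : R) : \bar R :=
  if t == 0 then lim ((EFin \o K) @ 0^')
  else if t == -1 then lim ((EFin \o K) @ (-1)^'+)
  else if t == 1 then lim ((EFin \o K) @ 1^'-)
  else (K t)%:E.

Definition singular_kernel (K : R -> R) : Prop := kernel_ext K 0 = -oo%E.

Definition strictly_concave_kernel (K : R -> R) : Prop :=
  strictly_concave_on `]-1, 0[ K /\ strictly_concave_on `]0, 1[ K.

Definition strictly_monotone_kernel (K : R -> R) : Prop :=
  {in `[-1, 0[ &, forall s t, s < t -> (kernel_ext K t < kernel_ext K s)%E} /\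
  {in `]0, 1] &, forall s t, s < t -> (kernel_ext K s < kernel_ext K t)%E}.

End Kernel.

Section Field.
Context {R : realType}.

Definition point_weight (t : R) : R :=
  if (t == 0) || (t == 1) then 2^-1 else 1.

(* J is total, but only its values on [0,1] matter. Boundedness above already
   excludes the value +oo there. The weighted number of points with finite
   value may be infinite: it exceeds n iff that of some finite set of such
   points, listed without repetition in s, does. *)
Definition field_function (n : nat) (J : R -> \bar R) : Prop :=
  (exists M : R, {in `[0, 1], forall t, (J t <= M%:E)%E}) /\
  (exists s : seq R,
    [/\ uniq s, {in s, forall t, t \in `[0, 1] /\ J t \is a fin_num} &
        n%:R < \sum_(t <- s) point_weight t]).

(* Upper semicontinuity relative to [0,1]. *)
Definition usc01 (J : R -> \bar R) : Prop :=
  lower_semicontinuous ((fun t => - J t)%E : subspace `[0, 1] -> \bar R).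

End Field.

Section Maximin.
Context {R : realType} {n : nat}.
Implicit Type y : 'rV[R]_n.

(* The nodes y_1, ..., y_n are the entries y 0 0, ..., y 0 (n-1), completed by
   y_0 = 0 and y_(n+1) = 1. *)
Definition node y (j : nat) : R :=
  if j is i.+1 then oapp (y 0) 1 (insub i : option 'I_n) else 0.

Definition simplex : set 'rV[R]_n :=
  [set y | forall j : 'I_n.+1, node y j < node y j.+1].

Definition closed_simplex : set 'rV[R]_n :=
  [set y | forall j : 'I_n.+1, node y j <= node y j.+1].

Variables (r : 'I_n -> R) (K : R -> R) (J : R -> \bar R).

Definition sum_translates y (t : R) : \bar R :=
  (J t + \sum_(j < n) (r j)%:E * kernel_ext K (t - y 0 j)%R)%E.

Definition interval_max y (j : 'I_n.+1) : \bar R :=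
  ereal_sup [set sum_translates y t | t in `[node y j, node y j.+1]].

Definition min_interval_max y : \bar R :=
  \big[mine/+oo%E]_(j < n.+1) interval_max y j.

Definition regularity_set : set 'rV[R]_n :=
  [set y | simplex y /\ forall j, interval_max y j != -oo%E].

Definition maximin_point y : Prop :=
  closed_simplex y /\
  forall z, closed_simplex z -> (min_interval_max z <= min_interval_max y)%E.

Definition equioscillation_point y : Prop :=
  forall i j, interval_max y i = interval_max y j.

End Maximin.

(* Main.v *)
Require Import Defs.
From mathcomp Require Import all_boot all_order all_algebra.
From mathcomp Require Import all_classical all_reals all_analysis.
From mathcomp Require Import ring lra.
Import Order.TTheory GRing.Theory Num.Theory.
Import numFieldNormedType.Exports.
Local Open Scope classical_set_scope.
Local Open Scope ring_scope.

(** Suppose that at a maximin point some interval has a maximum strictly above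
    the minimum [M] of all of them. Narrow that interval slightly: move its left
    end node right and its right end node left, at speeds inverse to their
    weights. Seen from any point outside the interval, the two nodes lie on the
    same side, where [K] is strictly concave, and moving them towards each other
    with a fixed weighted mean increases [F] there
    ([strictly_concave_shift], [sum_narrowing_gt]); for the first and the last
    interval only one node moves and strict monotonicity of [K] has the same
    effect. Each other interval grows, so if its maximum is attained, the value
    at the old maximizer shows that its maximum has strictly increased
    ([interval_max_narrowing_gt]). The narrowed interval has lost only a little
    ([interval_max_shift_gt]), so all maxima now exceed [M], against maximality
    ([maximin_equioscillation]).

    Attainment holds because [F] is upper semicontinuous
    ([interval_max_attained]): [J] is, and the singular kernel, extended by
    [-oo] at 0, is too. The argument needs distinct nodes and finite maxima.
    Both come from one comparison ([maximin_regular]): a point system with all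
    interval maxima finite exists ([regular_exists]), whereas a degenerate
    interval consists of a node, where [F] is [-oo]. *)

(** * Strictly concave functions on an open interval *)

Section StrictConcavity.
Context {R : realType}.
Variables (l u : R) (f : R -> R).
Hypothesis conc : strictly_concave_on `]l, u[ f.

Lemma strictly_concave_chord x y z : l < x -> x < y -> y < z -> z < u ->
  (z - y) * f x + (y - x) * f z < (z - x) * f y.
Proof.
move=> lx xy yz zu.
have zx : 0 < z - x by lra.
have xin : x \in [set` `]l, u[] by rewrite inE /= in_itv /=; lra.
have zin : z \in [set` `]l, u[] by rewrite inE /= in_itv /=; lra.
have p01 : 0 < (z - y) / (z - x) < 1.
  by rewrite divr_gt0 ?ltr_pdivrMr ?mul1r //=; lra.
have xz : x != z by rewrite lt_eqF //; lra.
have := conc _ _ xin zin xz _ p01.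
have -> : (z - y) / (z - x) * x + (1 - (z - y) / (z - x)) * z = y.
  by field; rewrite gt_eqF.
rewrite -(ltr_pM2l zx); congr (_ < _); field; by rewrite gt_eqF.
Qed.

(** Slopes of a strictly concave function decrease; comparing chords over
    adjacent intervals twice, with [x2, x3] in the middle, allows a gap. *)
Lemma strictly_concave_slope x1 x2 x3 x4 :
  l < x1 -> x1 < x2 -> x2 <= x3 -> x3 < x4 -> x4 < u ->
  (f x4 - f x3) * (x2 - x1) < (f x2 - f x1) * (x4 - x3).
Proof.
move=> lx1 x12 x23 x34 x4u.
move: x23; rewrite le_eqVlt => /predU1P[e|x23].
  rewrite -e in x34 *; have := strictly_concave_chord _ _ _ lx1 x12 x34 x4u; nra.
have c1 := strictly_concave_chord _ _ _ lx1 x12 x23 (lt_trans x34 x4u).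
have c2 := strictly_concave_chord _ _ _ (lt_trans lx1 x12) x23 x34 x4u.
have b0 : 0 < x3 - x2 by lra.
have e1 : 0 < (x4 - x3) * ((x3 - x1) * f x2 - ((x3 - x2) * f x1 + (x2 - x1) * f x3)).
  by apply: mulr_gt0; lra.
have e2 : 0 < (x2 - x1) * ((x4 - x2) * f x3 - ((x4 - x3) * f x2 + (x3 - x2) * f x4)).
  by apply: mulr_gt0; lra.
rewrite -(ltr_pM2l b0); lra.
Qed.

(** The perturbation principle. Pushing [x] right by [h / p] and [y] left by
    [h / q] leaves the weighted mean of the two arguments unchanged while
    bringing them closer together, so that the [p], [q]-weighted sum of the
    values of a strictly concave function goes up. *)
Lemma strictly_concave_shift p q h x y : l < x -> y < u -> 0 < p -> 0 < q ->
    0 < h -> x + h / p <= y - h / q ->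
  q * f y + p * f x < q * f (y - h / q) + p * f (x + h / p).
Proof.
move=> lx yu p0 q0 h0 xy.
have hp : 0 < h / p by rewrite divr_gt0.
have hq : 0 < h / q by rewrite divr_gt0.
have slope := @strictly_concave_slope x (x + h / p) (y - h / q) y lx.
have {}slope : (f y - f (y - h / q)) * (h / p) < (f (x + h / p) - f x) * (h / q).
  have -> : h / p = x + h / p - x by ring.
  have -> : h / q = y - (y - h / q) by ring.
  rewrite (subrKC x) opprB [y + _]addrC subrK; apply: slope => //; lra.
have pq0 : 0 < p * q / h by rewrite !(mulr_gt0, invr_gt0).
have e1 : p * q / h * ((f y - f (y - h / q)) * (h / p)) =
  q * (f y - f (y - h / q)) by field; rewrite !gt_eqF.
have e2 : p * q / h * ((f (x + h / p) - f x) * (h / q)) =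
  p * (f (x + h / p) - f x) by field; rewrite !gt_eqF.
rewrite -(ltr_pM2l pq0) e1 e2 in slope; lra.
Qed.

(** Chords through [x] and a fixed point on either side of it squeeze the graph
    near [x] between two lines, hence a local Lipschitz bound. *)
Lemma strictly_concave_continuous x : l < x -> x < u ->
  {for x, continuous f}.
Proof.
move=> lx xu.
pose a := (l + x) / 2; pose b := (x + u) / 2.
have [la ax xb bu] : [/\ l < a, a < x, x < b & b < u] by rewrite /a /b; split; lra.
pose A := (f x - f a) / (x - a); pose B := (f b - f x) / (b - x).
have fa : f a = f x - A * (x - a) by rewrite /A; field; rewrite gt_eqF //; lra.
have fb : f b = f x + B * (b - x) by rewrite /B; field; rewrite gt_eqF //; lra.
(* The summand 1 keeps [C] positive even if both slopes vanish. *)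
pose C := `|A| + `|B| + 1.
have C0 : 0 < C by rewrite /C ltr_wpDl// addr_ge0.
have lip s : a < s -> s < b -> `|f x - f s| <= C * `|x - s|.
  move=> sa sb.
  have [sx|xs|->] := ltgtP s x; last by rewrite !subrr normr0 mulr0.
  - have c1 := strictly_concave_chord _ _ _ la sa sx xu.
    have c2 := strictly_concave_chord _ _ _ (lt_trans la sa) sx xb bu.
    have e1 : f x - f s < A * (x - s).
      by rewrite -(@ltr_pM2l _ (x - a)); [nra|lra].
    have e2 : B * (x - s) < f x - f s.
      by rewrite -(@ltr_pM2l _ (b - x)); [nra|lra].
    have nA := ler_norm A; have nB := ler_norm (- B); rewrite normrN in nB.
    have nA' := normr_ge0 A; have nB' := normr_ge0 B.
    rewrite (@gtr0_norm _ (x - s)) ?subr_gt0// ler_norml /C; apply/andP; split; nra.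
  - have c1 := strictly_concave_chord _ _ _ lx xs sb bu.
    have c2 := strictly_concave_chord _ _ _ la ax xs (lt_trans sb bu).
    have e1 : f s - f x < A * (s - x).
      by rewrite -(@ltr_pM2l _ (x - a)); [nra|lra].
    have e2 : B * (s - x) < f s - f x.
      by rewrite -(@ltr_pM2l _ (b - x)); [nra|lra].
    have nA := ler_norm A; have nB := ler_norm (- B); rewrite normrN in nB.
    have nA' := normr_ge0 A; have nB' := normr_ge0 B.
    rewrite (@ltr0_norm _ (x - s)) ?subr_lt0// ler_norml /C; apply/andP; split; nra.
apply/cvgrPdist_le => e e0.
near=> s.
apply: le_trans (lip s _ _) _; [by near: s; exact: lt_nbhsr|by near: s; exact: lt_nbhsl|].
rewrite -ler_pdivlMl //.
near: s.
have : (fun s : R => s) @ x --> x by exact: cvg_id.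
by move/cvgrPdist_le; apply; rewrite mulr_gt0 ?invr_gt0.
Unshelve. all: by end_near. Qed.

End StrictConcavity.

(** * Upper limits and upper semicontinuity *)

(** The upper limit of [f] along [F] is at most [v]. With [v] the value of [f]
    at a point and [F] the trace of its neighbourhoods on a set, this is upper
    semicontinuity at that point relative to the set. *)
Definition limsup_le {R : realType} {T : Type} (F : set_system T)
    (f : T -> \bar R) (v : \bar R) :=
  forall c : R, (v < c%:E)%E -> \forall s \near F, (f s < c%:E)%E.

Section Limsup.
Context {R : realType}.

Lemma lte_split (a b : \bar R) (c : R) : (a < +oo)%E -> (b < +oo)%E ->
  (a + b < c%:E)%E -> exists u : R, (a < u%:E)%E /\ (b < (c - u)%:E)%E.
Proof.
move: a b => [x| |] [y| |] // _ _.
- rewrite -EFinD lte_fin => xyc; exists (x + (c - x - y) / 2).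
  by rewrite !lte_fin; lra.
- by exists (x + 1); rewrite lte_fin ltNyr; split => //; lra.
- by exists (c - y - 1); rewrite lte_fin ltNyr; split => //; lra.
- by exists 0; rewrite !ltNyr.
Qed.

Lemma lte_between_real (a b : \bar R) : (a < b)%E ->
  exists c : R, (a < c%:E)%E /\ (c%:E < b)%E.
Proof.
move: a b => [x| |] [y| |] //.
- rewrite lte_fin => xy; exists ((x + y) / 2).
  by rewrite !lte_fin; lra.
- by exists (x + 1); rewrite lte_fin ltry; split => //; lra.
- by exists (y - 1); rewrite lte_fin ltNyr; split => //; lra.
- by exists 0; rewrite ltNyr ltry.
Qed.

Context {T : Type} (F : set_system T) {FF : Filter F}.

Lemma limsup_leD (f g : T -> \bar R) v w : (v < +oo)%E -> (w < +oo)%E ->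
  limsup_le F f v -> limsup_le F g w ->
  limsup_le F (fun s => f s + g s)%E (v + w)%E.
Proof.
move=> vy wy fv gw c /lte_split-/(_ vy wy)[u [/fv fu /gw gu]].
apply: filterS2 fu gu => s fs gs.
by rewrite -(subrK u c) addrC EFinD lteD.
Qed.

Lemma limsup_leZ (p : R) (f : T -> \bar R) v : 0 < p ->
  limsup_le F f v -> limsup_le F (fun s => p%:E * f s)%E (p%:E * v)%E.
Proof.
move=> p0 fv c; rewrite muleC -lte_pdivlMr // -EFinM => /fv.
by apply: filterS => s; rewrite EFinM lte_pdivlMr // muleC.
Qed.

Lemma limsup_le_sum (I : Type) (s : seq I) (f : I -> T -> \bar R)
    (v : I -> \bar R) : (forall i, v i < +oo)%E ->
  (forall i, limsup_le F (f i) (v i)) ->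
  limsup_le F (fun x => \sum_(i <- s) f i x)%E (\sum_(i <- s) v i)%E.
Proof.
move=> vy fv; elim: s => [|i s IHs].
  rewrite big_nil => c c0; near=> x; by rewrite big_nil.
rewrite big_cons => c cs.
have sy : (\sum_(j <- s) v j < +oo)%E by apply: lte_sum_pinfty => j _.
have := limsup_leD _ _ _ _ (vy i) sy (fv i) IHs _ cs.
by apply: filterS => x; rewrite big_cons.
Unshelve. all: by end_near. Qed.

End Limsup.

(** The superlevel sets of all heights below the supremum form a filter on a
    compact interval; upper semicontinuity forces the value at a cluster point
    of it to be at least each of these heights. *)
Lemma usc_sup_attained {R : realType} (a b : R) (f : R -> \bar R) : a <= b ->
  {in `[a, b], forall t, limsup_le (within `[a, b] (nbhs t)) f (f t)} ->
  exists2 t, t \in `[a, b] & ereal_sup [set f t | t in `[a, b]] = f t.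
Proof.
move=> ab uscf; set M := ereal_sup _.
have fM t : t \in `[a, b] -> (f t <= M)%E.
  by move=> tab; apply: ereal_sup_ubound; exists t.
have ain : a \in `[a, b] by rewrite in_itv /= lexx.
case: (eqVneq M -oo%E) => [MNy|MNy].
  by exists a => //; apply/eqP; rewrite eq_le fM // MNy leNye.
pose D := [set c : \bar R | (c < M)%E].
pose B c := [set t | t \in `[a, b] /\ (c < f t)%E].
have FF : Filter (filter_from D B).
  apply: filter_from_filter; first by exists -oo%E; rewrite /D /= ltNye.
  move=> c d cM dM; exists (maxe c d); first by rewrite /D /= gt_max cM.
  by move=> t [tab]; rewrite gt_max => /andP[ct dt]; split.
have PF : ProperFilter (filter_from D B).
  apply: filter_from_proper => c /ereal_sup_gt[_ [t tab <-] ct].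
  by exists t.
have [] := @segment_compact R a b (filter_from D B) PF.
  by exists -oo%E; [rewrite /D /= ltNye|move=> t []].
move=> t [tab clt]; exists t => //; apply/eqP; rewrite eq_le fM // andbT.
rewrite leNgt; apply/negP => /lte_between_real[c [ftc cM]].
have Bc : filter_from D B (B c%:E) by exists c%:E.
have [s [[sab cfs] /=]] := clt _ _ Bc (uscf t tab c ftc).
by move/(_ sab); rewrite ltNge (ltW cfs).
Qed.

(** * The extended kernel *)

Section Kernel.
Context {R : realType} (K : R -> R).
Hypotheses (kerK : kernel_function K) (singK : singular_kernel K).
Hypothesis concK : strictly_concave_kernel K.

Lemma kernel_extE x : -1 < x < 1 -> x != 0 -> kernel_ext K x = (K x)%:E.
Proof.
move=> /andP[x1 x2] x0.
by rewrite /kernel_ext (negbTE x0) (gt_eqF x1) (lt_eqF x2).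
Qed.

Lemma kernel_ext_lty x : -1 < x < 1 -> (kernel_ext K x < +oo)%E.
Proof.
have [->|x0] := eqVneq x 0; first by rewrite singK.
by move=> /kernel_extE/(_ x0) ->; rewrite ltry.
Qed.

Lemma kernel_continuous x : -1 < x < 1 -> x != 0 -> {for x, continuous K}.
Proof.
move=> /andP[x1 x2]; rewrite neq_lt => /orP[x0|x0].
  exact: strictly_concave_continuous _ _ _ concK.1 _ x1 x0.
exact: strictly_concave_continuous _ _ _ concK.2 _ x0 x2.
Qed.

(** [kernel_ext K 0] is a total [lim], which carries information only because
    the two one-sided limits of the kernel at 0 agree. *)
Lemma kernel_cvg0 : (EFin \o K) @ 0^' --> -oo%E.
Proof.
have [_ _ [l [Kl Kr]]] := kerK.
have Kd : (EFin \o K) @ 0^' --> l.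
  move=> U Ul; have := Kl U Ul; have := Kr U Ul.
  rewrite /= !near_simpl /at_right /at_left /dnbhs !near_withinE => ur ul.
  apply: filterS2 ur ul => x ur ul x0.
  have /orP[] : (x < 0) || (0 < x) by rewrite -neq_lt.
    exact: ul.
  exact: ur.
rewrite -singK /singular_kernel/kernel_ext eqxx.
by rewrite (cvg_lim (@ereal_hausdorff R) Kd).
Qed.

(** Singularity makes the extended kernel upper semicontinuous even at 0. *)
Lemma kernel_ext_usc (x : R) : -1 < x < 1 ->
  limsup_le (nbhs x) (kernel_ext K) (kernel_ext K x).
Proof.
move=> x1 c; have [->|x0] := eqVneq x 0 => xc.
  have /cvgeNyPlt/(_ c) := kernel_cvg0; rewrite near_withinE => Kc.
  near=> s; have [->|s0] := eqVneq s 0; first by rewrite singK ltNyr.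
  have s1 : -1 < s < 1.
    by apply/andP; split; near: s; [apply: lt_nbhsr|apply: lt_nbhsl]; lra.
  by rewrite kernel_extE //; move: s0; near: s.
move/andP: (x1) => [x2 x3].
rewrite kernel_extE // lte_fin in xc.
have Kx := kernel_continuous _ x1 x0.
near=> s.
have s1 : -1 < s < 1.
  by apply/andP; split; near: s; [apply: lt_nbhsr|apply: lt_nbhsl].
have s0 : s != 0.
  near: s; move: x0; rewrite neq_lt => /orP[x0|x0].
    by apply: filterS (lt_nbhsl x0) => s s0; rewrite lt_eqF.
  by apply: filterS (lt_nbhsr x0) => s s0; rewrite gt_eqF.
by rewrite kernel_extE // lte_fin; near: s; exact: (cvgr_lt _ Kx).
Unshelve. all: by end_near. Qed.

End Kernel.

(** * Systems of nodes *)

Section Nodes.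
Context {R : realType} {n : nat}.
Implicit Types y : 'rV[R]_n.

Lemma node_ord y (i : 'I_n) : node y i.+1 = y 0 i.
Proof. by rewrite /node /= valK. Qed.

Lemma node_last y : node y n.+1 = 1.
Proof. by rewrite /node /= insubF //= ltnn. Qed.

Lemma node_le y i j : closed_simplex y -> (i <= j)%N -> (j <= n.+1)%N ->
  node y i <= node y j.
Proof.
move=> yS; elim: j => [|j IHj]; first by rewrite leqn0 => /eqP ->.
rewrite leq_eqVlt => /predU1P[-> //|]; rewrite ltnS => ij jn.
by apply: le_trans (IHj ij (ltnW jn)) (yS (Ordinal jn)).
Qed.

Lemma node_lt y i j : simplex y -> (i < j)%N -> (j <= n.+1)%N ->
  node y i < node y j.
Proof.
move=> yS; elim: j => // j IHj; rewrite ltnS leq_eqVlt => /predU1P[->|ij] jn.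
  exact: (yS (Ordinal jn)).
exact: lt_trans (IHj ij (ltnW jn)) (yS (Ordinal jn)).
Qed.

Lemma simplex_closed y : simplex y -> closed_simplex y.
Proof. by move=> yS j; apply/ltW/yS. Qed.

Lemma simplex_itv y (i : 'I_n) : simplex y -> 0 < y 0 i < 1.
Proof.
move=> yS; rewrite -node_ord (node_lt y 0) //=; last by rewrite ltnW // ltnS.
by have := node_lt y i.+1 n.+1 yS; rewrite node_last => -> //; rewrite ltnS.
Qed.

Lemma interval_sub01 y (j : 'I_n.+1) t : closed_simplex y ->
  t \in `[node y j, node y j.+1] -> t \in `[0, 1].
Proof.
move=> yS; rewrite !in_itv /= => /andP[jt tj].
rewrite (le_trans (node_le y 0 j yS _ _) jt) //=; last exact: ltnW.
apply: (le_trans tj).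
by have := node_le y j.+1 n.+1 yS (ltn_ord j); rewrite node_last => ->.
Qed.

(** An interval that degenerates to a point consists of a node [y 0 i]: it
    cannot reduce to 0 or to 1 without an adjacent node sitting there, since the
    two fixed end nodes differ. *)
Lemma closed_simplexN y : closed_simplex y -> ~ simplex y ->
  exists (j : 'I_n.+1) (i : 'I_n), node y j = y 0 i /\ node y j.+1 = y 0 i.
Proof.
move=> yc /existsNP[j /negP]; rewrite -leNgt => jj.
have {}jj : node y j = node y j.+1 by apply/eqP; rewrite eq_le jj yc.
exists j; case: (ltnP j n) => [jn|nj].
  by exists (Ordinal jn); rewrite jj -node_ord.
have {nj}jn : j = n :> nat by apply/eqP; rewrite eqn_leq nj -ltnS ltn_ord.
have [j0|j0] := posnP j.
  have : node y j.+1 = 1 by rewrite jn node_last.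
  by rewrite -jj j0 => /esym/eqP; rewrite oner_eq0.
have jn' : (j.-1 < n)%N.
  by apply: leq_trans (leqnn n); rewrite -[X in (_ < X)%N]jn ltn_predL.
have yj : node y j = y 0 (Ordinal jn').
  by rewrite -node_ord; congr (node y _); rewrite [LHS](esym (prednK j0)).
by exists (Ordinal jn'); rewrite -jj yj.
Qed.

End Nodes.

(** * Sums of translates and the regularity of maximin points *)

Section Translates.
Context {R : realType} {n : nat} (K : R -> R) (J : R -> \bar R) (r : 'I_n -> R).
Hypotheses (kerK : kernel_function K) (singK : singular_kernel K).
Hypotheses (concK : strictly_concave_kernel K).
Hypotheses (fieldJ : field_function n J) (uscJ : usc01 J).
Hypothesis r_gt0 : forall j, 0 < r j.
Implicit Types y : 'rV[R]_n.

Let F := sum_translates r K J.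
Let m := interval_max r K J.

Lemma field_lty t : t \in `[0, 1] -> (J t < +oo)%E.
Proof. by have [[M JM] _] := fieldJ; move=> /JM /le_lt_trans; apply; rewrite ltry. Qed.

Lemma translate_itv y t i : simplex y -> t \in `[0, 1] -> -1 < t - y 0 i < 1.
Proof.
move=> /simplex_itv-/(_ i)/andP[y0 y1]; rewrite in_itv /= => /andP[t0 t1].
lra.
Qed.

Lemma sum_translatesE y t : simplex y -> t \in `[0, 1] ->
  (forall i, t != y 0 i) ->
  F y t = (J t + (\sum_(j < n) r j * K (t - y 0 j))%:E)%E.
Proof.
move=> yS t01 ty; rewrite /F /sum_translates -sumEFin; congr (_ + _)%E.
by apply: eq_bigr => j _; rewrite kernel_extE ?subr_eq0 ?translate_itv.
Qed.

(** The term of index [i] is [-oo] by singularity, and [-oo] absorbs every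
    other term, whatever its value. *)
Lemma sum_translates_node y i : F y (y 0 i) = -oo%E.
Proof.
rewrite /F /sum_translates (bigD1 i) //= subrr singK.
by rewrite gt0_muleNy ?lte_fin ?r_gt0 // addNye addeNy.
Qed.

Lemma sum_translates_finite y t : simplex y -> t \in `[0, 1] ->
  F y t != -oo%E -> J t \is a fin_num /\ forall i, t != y 0 i.
Proof.
move=> yS t01 Ft; split.
  rewrite fin_numE (lt_eqF (field_lty _ t01)) andbT.
  by apply: contraNneq Ft => Jt; rewrite /F /sum_translates Jt addNye.
by move=> i; apply: contraNneq Ft => ->; rewrite sum_translates_node.
Qed.

Lemma field_usc (t : R) : t \in `[0, 1] ->
  limsup_le (within `[0, 1] (nbhs t)) J (J t).
Proof.
move=> t01 c Jtc.
have [|V] := @uscJ t (- c); first by rewrite EFinN lteN2.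
have tA : ([set` `[0, 1]] : set R) t := t01.
rewrite -[X in X V](nbhs_subspace_in tA) => tV Vc.
by apply: filterS tV => s /Vc; rewrite EFinN lteN2.
Qed.

Lemma sum_translates_usc y (t : R) : simplex y -> t \in `[0, 1] ->
  limsup_le (within `[0, 1] (nbhs t)) (F y) (F y t).
Proof.
move=> yS t01.
have Ky i : (kernel_ext K (t - y 0 i)%R < +oo)%E.
  by apply: kernel_ext_lty => //; apply: translate_itv.
have rKy i : ((r i)%:E * kernel_ext K (t - y 0 i)%R < +oo)%E.
  by rewrite lte_mul_pinfty ?lee_fin ?(ltW (r_gt0 i)).
apply: limsup_leD; [exact: field_lty| |exact: field_usc|].
  by apply: lte_sum_pinfty => i _.
apply: limsup_le_sum => // i; apply: limsup_leZ => // c.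
move=> /(kernel_ext_usc _ kerK singK concK _ (translate_itv y t i yS t01)) Kc.
apply: cvg_within.
have : (fun s => s - y 0 i) @ t --> t - y 0 i.
  by apply: cvgB; [exact: cvg_id|exact: cvg_cst].
by move=> sh; exact: (sh _ Kc).
Qed.

(** Attainment is what lets a strict increase of [sum_translates] at a single
    point of an interval pass to its supremum there. *)
Lemma interval_max_attained y (j : 'I_n.+1) : simplex y ->
  exists2 t, t \in `[node y j, node y j.+1] & m y j = F y t.
Proof.
move=> yS; have yc := simplex_closed _ yS.
apply: usc_sup_attained => [|t tj]; first exact: yc.
have t01 := interval_sub01 _ _ _ yc tj.
move=> c /(sum_translates_usc _ _ yS t01); rewrite !near_withinE.
by apply: filterS => s sc sj; apply/sc/(interval_sub01 _ _ _ yc sj).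
Qed.

Lemma interval_max_ge y (j : 'I_n.+1) t : t \in `[node y j, node y j.+1] ->
  (F y t <= m y j)%E.
Proof. by move=> tj; apply: ereal_sup_ubound; exists t. Qed.

Lemma interval_max_degenerate y : closed_simplex y -> ~ simplex y ->
  exists j, m y j = -oo%E.
Proof.
move=> yc /closed_simplexN-/(_ yc)[j [i [ji ji']]]; exists j.
apply/ereal_sup_ninfty => _ [t tj <-].
have : t \in `[node y j, node y j.+1] := tj; rewrite ji ji' in_itv /= -eq_le.
by move=> /eqP <-; apply: sum_translates_node.
Qed.

(** The weights of points being at most 1, the field is finite at [n + 1]
    distinct points. Placing one node halfway between each two consecutive
    ones leaves one of these points in each interval, away from the nodes. *)
Lemma regular_exists : exists2 z, simplex z & forall j, m z j != -oo%E.
Proof.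
have [_ [s [us sJ sn]]] := fieldJ.
have {}sn : (n < size s)%N.
  rewrite -(ltr_nat R); apply: (lt_le_trans sn).
  rewrite -sum1_size natr_sum; apply: ler_sum => t _.
  by rewrite /point_weight; case: ifP => _; lra.
pose s' := sort <=%R s; pose tau := nth 0 s'.
have ss' : size s' = size s by rewrite size_sort.
have tauJ i : (i <= n)%N -> 0 <= tau i <= 1 /\ J (tau i) \is a fin_num.
  move=> ni; have : tau i \in s.
    by rewrite -(mem_sort <=%R) mem_nth // ss'; apply: leq_ltn_trans sn.
  by move=> /sJ; rewrite in_itv.
have tau_lt i j : (i < j)%N -> (j <= n)%N -> tau i < tau j.
  move=> ij jn; have srt : sorted <%R s' by rewrite sort_lt_sorted.
  have jn' := leq_ltn_trans jn sn.
  apply: (sorted_ltn_nth lt_trans 0 srt) => //; rewrite inE ss' //.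
  exact: ltn_trans ij jn'.
have tau_le i j : (i <= j)%N -> (j <= n)%N -> tau i <= tau j.
  by rewrite leq_eqVlt => /predU1P[-> //|ij jn]; apply/ltW/tau_lt.
pose z : 'rV[R]_n := \row_i ((tau i + tau i.+1) / 2).
have zE (i : 'I_n) : tau i < z 0 i < tau i.+1.
  by rewrite mxE; have := tau_lt _ _ (ltnSn i) (ltn_ord i); lra.
have node_tau (j : 'I_n.+1) : (0 < j)%N -> node z j < tau j.
  case: j => [[//|j] jn] _ /=.
  by have /andP[_] := zE (Ordinal (jn : (j < n)%N)); rewrite -node_ord.
have tau_node (j : 'I_n.+1) : (j < n)%N -> tau j < node z j.+1.
  by move=> jn; have /andP[+ _] := zE (Ordinal jn); rewrite -node_ord.
have node_tau_le (j : 'I_n.+1) : node z j <= tau j <= node z j.+1.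
  have [/andP[t0 t1] _] := tauJ j (ltn_ord j : (j <= n)%N).
  apply/andP; split.
    by case: (posnP j) => [j0|/node_tau/ltW //]; move: t0; rewrite j0.
  case: (ltnP j n) => [/tau_node/ltW //|nj].
  have jn : j = n :> nat by apply/eqP; rewrite eqn_leq nj -ltnS ltn_ord.
  by move: t1; rewrite jn node_last.
have zS : simplex z.
  move=> j; have /andP[l1 l2] := node_tau_le j.
  case: (posnP j) => [j0|/node_tau/lt_le_trans -> //].
  case: (ltnP j n) => [/tau_node/(le_lt_trans l1) //|nj].
  have n0 : n = 0%N by apply/eqP; rewrite -leqn0 -j0.
  have := node_last z; rewrite j0 {2}n0 => ->; exact: ltr01.
exists z => // j; rewrite -ltNye; apply: lt_le_trans (interval_max_ge _ _ (tau j) _).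
  have [t01 Jt] := tauJ j (ltn_ord j : (j <= n)%N).
  rewrite sum_translatesE //; first by rewrite -(fineK Jt) -EFinD ltNyr.
  move=> i; have /andP[z1 z2] := zE i; case: (leqP j i) => ij.
    by rewrite lt_eqF // (le_lt_trans _ z1) // tau_le // ltnW.
  by rewrite gt_eqF // (lt_le_trans z2) // tau_le // -ltnS.
by rewrite in_itv /= node_tau_le.
Qed.

(** At a maximin point no interval maximum is [-oo], because some system of
    nodes has this property; that excludes degenerate intervals. *)
Lemma maximin_regular y : maximin_point r K J y -> regularity_set r K J y.
Proof.
move=> [yc ymax]; have [z zS zm] := regular_exists.
have ym j : m y j != -oo%E.
  rewrite -ltNye; apply: lt_le_trans (bigmin_le _ j _).
  apply: lt_le_trans (ymax z (simplex_closed _ zS)).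
  by apply: lt_bigmin => // i _; rewrite ltNye; apply: zm.
split => //; apply: contrapT => /(interval_max_degenerate _ yc)[j mj].
by move: (ym j); rewrite mj.
Qed.

End Translates.

(** * Displacing the nodes *)

Section Shift.
Context {R : realType} {n : nat}.
Implicit Types y d : 'rV[R]_n.

Lemma node_shift_cvg y d i :
  (fun h : R => node (y + h *: d) i) @ (0 : R) --> node y i.
Proof.
case: i => [|i]; first exact: cvg_cst.
have [ni|ni] := ltnP i n; last first.
  rewrite /node /= insubF /=; first exact: cvg_cst.
  by apply: negbTE; rewrite -leqNgt.
rewrite -[i]/(nat_of_ord (Ordinal ni)) node_ord.
under eq_fun do rewrite node_ord !mxE.
have : (fun h : R => y 0 (Ordinal ni) + h * d 0 (Ordinal ni)) @ (0 : R) -->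
    y 0 (Ordinal ni) + 0 * d 0 (Ordinal ni).
  by apply: cvgD; [exact: cvg_cst|apply: cvgMr_tmp; exact: cvg_id].
by rewrite mul0r addr0.
Qed.

Lemma coord_shift_cvg y d (i : 'I_n) :
  (fun h : R => (y + h *: d) 0 i) @ (0 : R) --> y 0 i.
Proof.
have := node_shift_cvg y d i.+1; rewrite node_ord.
by under eq_fun do rewrite node_ord.
Qed.

Lemma simplex_shift y d : simplex y ->
  \forall h \near (0 : R), simplex (y + h *: d).
Proof.
move=> yS.
apply: (@filter_forall R 'I_n.+1
  (fun j h => node (y + h *: d) j < node (y + h *: d) j.+1) (nbhs (0 : R)) _) => j.
have c : (fun h : R => node (y + h *: d) j.+1 - node (y + h *: d) j) @ (0 : R)
    --> node y j.+1 - node y j.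
  apply: cvgB; exact: node_shift_cvg.
have : 0 < node y j.+1 - node y j by rewrite subr_gt0; exact: yS.
by move=> /(cvgr_gt _ c); apply: filterS => h; rewrite subr_gt0.
Qed.

Lemma not_node_shift y d (t : R) : (forall i, t != y 0 i) ->
  \forall h \near (0 : R), forall i, t != (y + h *: d) 0 i.
Proof.
move=> ty; apply: (@filter_forall R 'I_n
  (fun i h => t != (y + h *: d) 0 i) (nbhs (0 : R)) _) => i.
have c := coord_shift_cvg y d i.
have := ty i; rewrite neq_lt => /orP[ti|ti].
  by apply: filterS (cvgr_gt _ c _ ti) => h hi; rewrite lt_eqF.
by apply: filterS (cvgr_lt _ c _ ti) => h hi; rewrite gt_eqF.
Qed.

Lemma interval_interior y (j : 'I_n.+1) t : (forall i, t != y 0 i) ->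
    t \in `[node y j, node y j.+1] ->
  ((0 < j)%N -> node y j < t) /\ ((j < n)%N -> t < node y j.+1).
Proof.
move=> ty; rewrite in_itv /= => /andP[jt tj]; split.
  case: j jt {tj} => [[//|j] jn] jt _.
  rewrite lt_neqAle jt andbT eq_sym.
  by have /= -> := node_ord y (Ordinal (jn : (j < n)%N)).
move=> jn; rewrite lt_neqAle tj andbT.
by have /= -> := node_ord y (Ordinal jn).
Qed.

(** The points 0 and 1 need no room: an interval keeps its end 0 or 1 under any
    displacement of the nodes. *)
Lemma interval_shift y d (j : 'I_n.+1) t : (forall i, t != y 0 i) ->
    t \in `[node y j, node y j.+1] ->
  \forall h \near (0 : R),
    t \in `[node (y + h *: d) j, node (y + h *: d) j.+1].
Proof.
move=> ty tj; have [jt1 jt2] := interval_interior _ _ _ ty tj.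
move: (tj); rewrite in_itv => /andP[tj1 tj2].
have n1 : \forall h \near (0 : R), node (y + h *: d) j <= t.
  have [j0|/jt1 jt] := posnP j.
    by near=> h; move: tj1; rewrite j0.
  by apply: filterS (cvgr_lt _ (node_shift_cvg y d j) _ jt) => h /ltW.
have n2 : \forall h \near (0 : R), t <= node (y + h *: d) j.+1.
  have [/jt2 jt|nj] := ltnP j n.
    by apply: filterS (cvgr_gt _ (node_shift_cvg y d j.+1) _ jt) => h /ltW.
  have jn : j = n :> nat by apply/eqP; rewrite eqn_leq nj -ltnS ltn_ord.
  by near=> h; move: tj2; rewrite jn !node_last.
by apply: filterS2 n1 n2 => h h1 h2; rewrite in_itv /= h1.
Unshelve. all: by end_near. Qed.

End Shift.

(** * Narrowing one interval *)

Section Narrow.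
Context {R : realType} {n : nat} (K : R -> R) (J : R -> \bar R) (r : 'I_n -> R).
Hypotheses (kerK : kernel_function K) (singK : singular_kernel K).
Hypotheses (concK : strictly_concave_kernel K).
Hypotheses (monoK : strictly_monotone_kernel K).
Hypotheses (fieldJ : field_function n J) (uscJ : usc01 J).
Hypothesis r_gt0 : forall j, 0 < r j.
Implicit Types y d : 'rV[R]_n.

Let F := sum_translates r K J.
Let m := interval_max r K J.

Lemma kernel_decr s t : -1 < s -> s < t -> t < 0 -> K t < K s.
Proof.
move=> s1 st t0; have [+ _] := monoK => /(_ s t).
rewrite !in_itv /= t0 (lt_trans st t0) (ltW s1) (ltW (lt_trans s1 st)).
move=> /(_ isT isT st).
by rewrite !kernel_extE ?lte_fin //; lra.
Qed.

Lemma kernel_incr s t : 0 < s -> s < t -> t < 1 -> K s < K t.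
Proof.
move=> s0 st t1; have [_ +] := monoK => /(_ s t).
rewrite !in_itv /= s0 (lt_trans s0 st) (ltW t1) (ltW (lt_trans st t1)).
move=> /(_ isT isT st).
by rewrite !kernel_extE ?lte_fin //; lra.
Qed.

(** The direction that moves the left end node of the interval of index [k]
    rightwards and its right end node leftwards, at speeds inverse to their
    weights [r i]; if [k] is 0 or [n], only one of the two is a movable node. *)
Definition narrowing (k : 'I_n.+1) : 'rV[R]_n :=
  \row_i (((i.+1 == k)%:R - (i == k :> nat)%:R) / r i).

Lemma narrowing_left (k : 'I_n.+1) (i : 'I_n) :
  i.+1 = k -> narrowing k 0 i = (r i)^-1.
Proof. by move=> ik; rewrite mxE ik eqxx -ik ltn_eqF // subr0 mul1r. Qed.

Lemma narrowing_right (k : 'I_n.+1) (i : 'I_n) :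
  i = k :> nat -> narrowing k 0 i = - (r i)^-1.
Proof. by move=> ik; rewrite mxE ik eqxx gtn_eqF // sub0r mulN1r. Qed.

Lemma narrowing_other (k : 'I_n.+1) (i : 'I_n) : i.+1 != k -> i != k :> nat ->
  narrowing k 0 i = 0.
Proof. by move=> /negbTE ik /negbTE ik'; rewrite mxE ik ik' subrr mul0r. Qed.

(** Narrowing one interval raises the sum of translates outside it. From a point
    outside, both moving nodes are seen on the same side, so that [K] is
    evaluated inside a single branch of strict concavity and
    [strictly_concave_shift] applies. At the two extreme intervals a single
    node moves, away from the point, and monotonicity of [K] takes over. *)
Lemma sum_narrowing_gt y (j k : 'I_n.+1) t h : simplex y ->
    j != k -> 0 < h -> simplex (y + h *: narrowing k) ->
    (forall i, t != y 0 i) -> t \in `[node y j, node y j.+1] ->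
  \sum_(i < n) r i * K (t - y 0 i) <
  \sum_(i < n) r i * K (t - (y + h *: narrowing k) 0 i).
Proof.
set z := y + h *: _ => yS jk h0 zS ty tj.
have yc := simplex_closed _ yS.
have t01 := interval_sub01 _ _ _ yc tj.
have [jt1 jt2] := interval_interior _ _ _ ty tj.
have ztr i : -1 < t - z 0 i < 1 := translate_itv _ _ i zS t01.
have ytr i : -1 < t - y 0 i < 1 := translate_itv _ _ i yS t01.
have zl (i : 'I_n) : i.+1 = k -> t - z 0 i = t - y 0 i - h / r i.
  by move=> ik; rewrite /z 2!mxE (narrowing_left _ _ ik) opprD addrA.
have zr (i : 'I_n) : i = k :> nat -> t - z 0 i = t - y 0 i + h / r i.
  by move=> ik; rewrite /z 2!mxE (narrowing_right _ _ ik) mulrN opprB addrA addrAC.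
have zo (i : 'I_n) : i.+1 != k -> i != k :> nat -> z 0 i = y 0 i.
  by move=> i1 i2; rewrite /z 2!mxE narrowing_other // mulr0 addr0.
have left_of (i : 'I_n) : (j < k)%N -> i.+1 = k -> t < y 0 i.
  move=> jk' ik; have jn : (j < n)%N by rewrite (leq_trans jk') // -ltnS.
  apply: (lt_le_trans (jt2 jn)); rewrite -node_ord ik node_le //.
  exact: ltnW.
have right_of (i : 'I_n) : (k < j)%N -> i = k :> nat -> y 0 i < t.
  move=> kj ik; have j0 : (0 < j)%N by apply: leq_ltn_trans kj.
  apply: le_lt_trans (jt1 j0); rewrite -node_ord ik node_le //.
  exact: ltnW.
have hr i : 0 < h / r i by rewrite divr_gt0.
(* The interval at the left end of [0, 1]: only its right end node moves. *)
have [k0|k0] := posnP k.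
  have kj : (k < j)%N by rewrite k0 lt0n -k0.
  have n0 : (0 < n)%N.
    by apply: (leq_trans _ (ltn_ord j : (j <= n)%N)); rewrite lt0n -k0.
  pose q := Ordinal n0; have qk : q = k :> nat by rewrite k0.
  rewrite (bigD1 q) //= [X in _ < X](bigD1 q) //=.
  rewrite [X in _ < _ + X](eq_bigr (fun i => r i * K (t - y 0 i))); last first.
    by move=> i iq; rewrite zo ?k0 // -qk.
  rewrite ltrD2r ltr_pM2l // zr //; apply: kernel_incr.
  - by rewrite subr_gt0 right_of.
  - by rewrite ltrDl.
  - by rewrite -zr //; case/andP: (ztr q).
have pn : (k.-1 < n)%N by rewrite -ltnS prednK.
pose p := Ordinal pn; have pk : p.+1 = k by rewrite /= prednK.
rewrite (bigD1 p) //= [X in _ < X](bigD1 p) //=.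
(* The interval at the right end of [0, 1]: only its left end node moves. *)
have [kn|nk] := ltnP k n; last first.
  have kn : k = n :> nat by apply/eqP; rewrite eqn_leq nk -ltnS ltn_ord.
  have jk' : (j < k)%N by rewrite ltn_neqAle jk kn -ltnS ltn_ord.
  rewrite [X in _ < _ + X](eq_bigr (fun i => r i * K (t - y 0 i))); last first.
    move=> i ip; rewrite zo //; first by rewrite -pk eqSS.
    by rewrite kn ltn_eqF.
  rewrite ltrD2r ltr_pM2l // zl //; apply: kernel_decr.
  - by rewrite -zl //; case/andP: (ztr p).
  - by rewrite gtrBl.
  - by rewrite subr_lt0 left_of.
pose q := Ordinal kn; have qk : q = k :> nat by [].
have qp : q != p by rewrite -val_eqE /= -[X in X != _](prednK k0) gtn_eqF.
rewrite (bigD1 q) //= [X in _ < _ + X](bigD1 q) //=.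
rewrite [X in _ < _ + (_ + X)](eq_bigr (fun i => r i * K (t - y 0 i))); last first.
  by move=> i /andP[ip iq]; rewrite zo // -pk eqSS.
rewrite !addrA ltrD2r zl // zr //.
have pq : t - y 0 q + h / r q <= t - y 0 p - h / r p.
  rewrite -zl // -zr // lerD2l lerN2 -!node_ord; apply: node_le.
  - exact: simplex_closed.
  - by rewrite ltnS /= ltnW // prednK.
  - exact: ltnW.
have [/andP[p1 p2] /andP[q1 q2]] := (ytr p, ytr q).
case: (ltnP j k) => jk'.
  apply: (strictly_concave_shift _ _ _ concK.1) => //.
  by rewrite subr_lt0 left_of.
have kj : (k < j)%N by rewrite ltn_neqAle eq_sym jk.
apply: (strictly_concave_shift _ _ _ concK.2) => //.
by rewrite subr_gt0 right_of.
Qed.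

Lemma sum_shift_cvg y d t : simplex y -> t \in `[0, 1] ->
    (forall i, t != y 0 i) ->
  (fun h : R => \sum_(i < n) r i * K (t - (y + h *: d) 0 i)) @ (0 : R) -->
  \sum_(i < n) r i * K (t - y 0 i).
Proof.
move=> yS t01 ty; apply: cvg_big => [|i _]; first exact: add_continuous.
apply: cvgMl_tmp.
have Kc : K @ (t - y 0 i) --> K (t - y 0 i).
  by apply: kernel_continuous; rewrite ?subr_eq0 ?translate_itv.
apply: cvg_comp Kc; apply: cvgB; [exact: cvg_cst|exact: coord_shift_cvg].
Qed.

(** Lower semicontinuity of an interval maximum along a line: near the original
    nodes the old maximizer stays in the interval and its value varies
    continuously. *)
Lemma interval_max_shift_gt y d j (c : \bar R) : simplex y -> (c < m y j)%E ->
  \forall h \near (0 : R), (c < m (y + h *: d) j)%E.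
Proof.
move=> yS cm.
have [t tj mt] :=
  interval_max_attained K J r kerK singK concK fieldJ uscJ r_gt0 y j yS.
have t01 := interval_sub01 _ _ _ (simplex_closed _ yS) tj.
rewrite /m mt in cm.
have Ft : sum_translates r K J y t != -oo%E by rewrite -ltNye (le_lt_trans (leNye c)).
have [Jt ty] := sum_translates_finite K J r singK fieldJ r_gt0 y t yS t01 Ft.
have [e [ce eF]] := lte_between_real _ _ cm.
rewrite sum_translatesE // -(fineK Jt) -EFinD lte_fin in eF.
have Sc := sum_shift_cvg y d t yS t01 ty.
rewrite -ltrBlDl in eF.
near=> h.
have hS : simplex (y + h *: d) by near: h; exact: simplex_shift.
apply: (lt_le_trans ce); apply: le_trans (interval_max_ge K J r _ j t _); last first.
  by near: h; exact: interval_shift.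
rewrite sum_translatesE //; last by near: h; exact: not_node_shift.
rewrite -(fineK Jt) -EFinD lee_fin -lerBlDl ltW //.
by near: h; exact: (cvgr_gt _ Sc _ eF).
Unshelve. all: by end_near. Qed.

(** The old maximizer of another interval still belongs to it after a small
    narrowing, and the value there has grown. *)
Lemma interval_max_narrowing_gt y (j k : 'I_n.+1) : regularity_set r K J y ->
    j != k ->
  \forall h \near (0 : R)^'+, (m y j < m (y + h *: narrowing k) j)%E.
Proof.
move=> [yS ym] jk.
have [t tj mt] :=
  interval_max_attained K J r kerK singK concK fieldJ uscJ r_gt0 y j yS.
have t01 := interval_sub01 _ _ _ (simplex_closed _ yS) tj.
have Ft : sum_translates r K J y t != -oo%E by rewrite -mt.
have [Jt ty] := sum_translates_finite K J r singK fieldJ r_gt0 y t yS t01 Ft.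
near=> h.
have h0 : 0 < h by [].
have hS : simplex (y + h *: narrowing k).
  by near: h; apply: cvg_within; exact: simplex_shift.
apply: (@lt_le_trans _ _ (sum_translates r K J (y + h *: narrowing k) t)).
  rewrite /m mt !sum_translatesE //; last first.
    by near: h; apply: cvg_within; exact: not_node_shift.
  by rewrite lteD2lE // lte_fin; apply: (sum_narrowing_gt _ j).
apply: interval_max_ge; near: h; apply: cvg_within; exact: interval_shift.
Unshelve. all: by end_near. Qed.

(** Narrowing an interval whose maximum exceeds the minimum [M] raises all other
    maxima above [M] and, by continuity, leaves that one above [M]. *)
Lemma maximin_equioscillation y : maximin_point r K J y ->
  equioscillation_point r K J y.
Proof.
move=> ymax; have yreg : regularity_set r K J y.
  exact: maximin_regular ymax.
have [yS _] := yreg.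
pose M := min_interval_max r K J y.
have Mm j : (M <= m y j)%E by exact: bigmin_le.
suff mM k : m y k = M by move=> i j; rewrite -/(m y i) -/(m y j) !mM.
apply: contrapT => /eqP; rewrite eq_sym => Mk.
have {}Mk : (M < m y k)%E by rewrite lt_neqAle Mk Mm.
have near_gt : \forall h \near (0 : R)^'+,
    forall j, (M < m (y + h *: narrowing k) j)%E.
  apply: (@filter_forall R 'I_n.+1
    (fun j h => M < m (y + h *: narrowing k) j)%E ((0 : R)^'+) _) => j.
  have [->|jk] := eqVneq j k.
    by apply: cvg_within; exact: interval_max_shift_gt.
  apply: filterS (interval_max_narrowing_gt y j k yreg jk) => h.
  exact: le_lt_trans.
have near_S : \forall h \near (0 : R)^'+, simplex (y + h *: narrowing k).
  by apply: cvg_within; exact: simplex_shift.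
have [h [hM hS]] := filter_ex (filterI near_gt near_S).
have := ymax.2 _ (simplex_closed _ hS).
rewrite leNgt => /negP; apply; apply: lt_bigmin => [|j _]; last exact: hM.
exact: lt_le_trans Mk (leey _).
Qed.

End Narrow.

Theorem theorem3p2 (R : realType) (n : nat) (K : R -> R) (J : R -> \bar R)
    (r : 'I_n -> R) (y : 'rV[R]_n)
    (kerK : kernel_function K) (singK : singular_kernel K)
    (concK : strictly_concave_kernel K) (monoK : strictly_monotone_kernel K)
    (fieldJ : field_function n J) (uscJ : usc01 J)
    (r_gt0 : forall j, 0 < r j)
    (maxy : maximin_point r K J y) :
  [/\ regularity_set r K J y,
      regularity_set r K J `<=` @simplex R n &
      equioscillation_point r K J y].
Proof.
split.
- exact: maximin_regular maxy.
- by move=> z [].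
- exact: maximin_equioscillation maxy.
Qed.
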